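(* Let $m,n$ be positive integers, $M=\{1,\dots,m\}$, $N=\{1,\dots,n\}$, $A\in\mathbb{R}^{M\times N}$ with $\mathrm{rk}(A)=m$, $b\in\mathbb{R}^M$, and consider the NNLS problem $\min\{\tfrac12\|Ax-b\|^2 : x\in\mathbb{R}^N,\ x\ge \mathbf{0}\}$ with optimum value $p^*$; let $\eta(x)=\tfrac12\|Ax-b\|^2-p^*$. Let $\Psi$ be a centroid mapping and let $x\ge\mathbf 0$ be a stable point. If $y=\mathrm{Update}(x)$ is the projected gradient update, then $$\eta(y)\le\left(1-\frac{1}{2m^2\cdot\kappa^2(\mathcal X_A)\cdot\|A\|^2}\right)\eta(x).$$ If $y=\mathrm{Update}(x)$ is the coordinate update, then $$\eta(y)\le\left(1-\frac{1}{2nm^2\cdot\kappa^2(\mathcal X_A)\cdot\|A\|^2}\right)\eta(x).$$ Consequently, there is an absolute constant $C$ such that, for the Update-and-Stabilize algorithm (described in the context) started from a stable point and run either with projected gradient or with coordinate updates, after performing at most $C\,n\,m^2\,\kappa^2(\mathcal X_A)\,\|A\|^2$ minor and major cycles from an iterate $x$, one obtains an iterate $x'$ with $\eta(x')\le\eta(x)/2$.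
   Context: $\|\cdot\|$ is the Euclidean norm of vectors and the spectral ($\ell_2\to\ell_2$ operator) norm of matrices. $A^j$ is the $j$th column of $A$. **Circuit imbalance.** For a linear subspace $W$, an elementary vector is a nonzero vector of $W$ of inclusion-minimal support; $\mathcal F(W)$ is the set of elementary vectors. For nontrivial $W$ (neither $\{\mathbf 0\}$ nor the whole space), $\kappa(W):=\max\{|g(j)/g(i)| : g\in\mathcal F(W),\ i,j\in\mathrm{supp}(g)\}$; $\kappa(W)=1$ for trivial $W$. Let $\mathcal X_A:=\ker(A\mid -I_M)=\{(v,Av):v\in\mathbb{R}^N\}\subset\mathbb{R}^{N\oplus M}$. **Centroid mappings (NNLS case).** For $x\ge\mathbf 0$ let $I_0(x)=\{i\in N:x(i)=0\}$ and $\mathcal C(x):=\arg\min_y\{\|Ay-b\| : y\in\mathbb{R}^N,\ y(i)=0\ \forall i\in I_0(x)\}$. A centroid mapping is a map $\Psi:\mathbb{R}^N_{\ge0}\to\mathbb{R}^N$ with $\Psi(x)\in\mathcal C(x)$ for all $x\ge \mathbf 0$ and $\Psi(\Psi(x))=\Psi(x)$ whenever $\Psi(x)\ge\mathbf 0$. A point $x\ge\mathbf 0$ is stable if $\Psi(x)=x$. **Algorithm.** Start from an initial point $x$. Repeat the following major cycle until $x=\mathrm{Update}(x)$, then return $x$ (which is then optimal): set $x\leftarrow\mathrm{Update}(x)$; then, while $\Psi(x)\neq x$, perform a minor cycle: let $w=\Psi(x)$, let $\alpha^*$ be the largest $\alpha\in[0,1]$ with $x+\alpha(w-x)\ge\mathbf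 0$, and set $x\leftarrow x+\alpha^*(w-x)$. (Thus $x$ is stable at the end of each major cycle.) Iterates are the points $x$ occurring at any time of the run (after an update or after a minor cycle). If the algorithm has terminated before the stated number of cycles, $x'$ is the returned optimal solution. **Updates at a stable point $x$.** Let $g^x=A^\top(Ax-b)$ and $z(i)=\max\{-g^x(i),0\}$ for $i\in N$. If $z=\mathbf 0$, then $\mathrm{Update}(x)=x$. Otherwise: - Projected gradient update: $\mathrm{Update}(x)=x+\frac{\|z\|^2}{\|Az\|^2}z$. - Coordinate update: choose $j\in\arg\max_k z(k)$ (then $j\in I_0(x)$) and let $\mathrm{Update}(x)=y$ with $y(i)=x(i)$ for $i\ne j$ and $y(j)=z(j)/\|A^j\|^2$. *)

(* Defs.v *)
From mathcomp Require Import all_boot all_order all_algebra.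
From mathcomp Require Import boolp classical_sets reals.

Set Implicit Arguments.
Unset Strict Implicit.
Unset Printing Implicit Defensive.

Import Order.TTheory GRing.Theory Num.Theory.
Local Open Scope ring_scope.

(* Vectors of R^k are column matrices; MathComp indices start at 0, so the set
   {1, ..., k} is represented by 'I_k. *)

Section Norms.
Context {R : realType}.

Definition l2norm k (v : 'cV[R]_k) : R := Num.sqrt (\sum_i v i 0 ^+ 2).

Definition spectral_norm m n (A : 'M[R]_(m, n)) : R :=
  sup [set l2norm (A *m v) | v in [set v : 'cV[R]_n | l2norm v <= 1]]%classic.

End Norms.

Section CircuitImbalance.
Context {R : realType}.

Definition supp k (g : 'cV[R]_k) : {set 'I_k} := [set i | g i 0 != 0]%SET.

Definition elementary k (W : {vspace 'cV[R]_k}) (g : 'cV[R]_k) : Prop :=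
  [/\ g \in W, g != 0 &
      forall h : 'cV[R]_k, h \in W -> h != 0 -> ~~ (supp h \proper supp g)].

(* Elementary vectors with the same support are proportional, so the set of
   ratios is finite; it is nonempty when W != 0. Hence sup is a maximum. *)
Definition kappa k (W : {vspace 'cV[R]_k}) : R :=
  if (W == 0%VS) || (W == fullv) then 1
  else sup [set r : R | exists g i j,
         [/\ elementary W g, i \in supp g, j \in supp g &
             r = `|g j 0 / g i 0| ]]%classic.

Definition XA m n (A : 'M[R]_(m, n)) : {vspace 'cV[R]_(n + m)} :=
  lker (linfun (mulmx (row_mx A (- 1%:M)) : 'cV[R]_(n + m) -> 'cV[R]_m)).

Lemma mem_XA m n (A : 'M[R]_(m, n)) (u : 'cV[R]_(n + m)) :
  u \in XA A <-> exists v : 'cV[R]_n, u = col_mx v (A *m v).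
Proof.
rewrite memv_ker lfunE /= -{1}[u]vsubmxK mul_row_col mulNmx mul1mx subr_eq0.
split=> [/eqP Av|[v ->]]; last by rewrite col_mxKu col_mxKd.
by exists (usubmx u); rewrite Av vsubmxK.
Qed.

End CircuitImbalance.

Section NNLS.
Context {R : realType} {m n : nat}.
Variables (A : 'M[R]_(m, n)) (b : 'cV[R]_m).

Definition nonneg k (x : 'cV[R]_k) : Prop := forall i, 0 <= x i 0.

Definition objective (x : 'cV[R]_n) : R := 2^-1 * l2norm (A *m x - b) ^+ 2.

Definition opt_value : R :=
  inf [set objective x | x in [set x | nonneg x]]%classic.

Definition gap (x : 'cV[R]_n) : R := objective x - opt_value.

Definition vanishes_on_I0 (x y : 'cV[R]_n) : Prop :=
  forall i, x i 0 = 0 -> y i 0 = 0.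

Definition centroid_set (x : 'cV[R]_n) : set 'cV[R]_n :=
  [set y | vanishes_on_I0 x y /\
     forall y', vanishes_on_I0 x y' ->
       l2norm (A *m y - b) <= l2norm (A *m y' - b)]%classic.

(* Psi is a total function, but only its values at nonnegative points matter. *)
Definition centroid_mapping (Psi : 'cV[R]_n -> 'cV[R]_n) : Prop :=
  (forall x, nonneg x -> centroid_set x (Psi x)) /\
  (forall x, nonneg x -> nonneg (Psi x) -> Psi (Psi x) = Psi x).

Definition stable (Psi : 'cV[R]_n -> 'cV[R]_n) (x : 'cV[R]_n) : Prop :=
  nonneg x /\ Psi x = x.

Definition gradient (x : 'cV[R]_n) : 'cV[R]_n := A^T *m (A *m x - b).

Definition descent (x : 'cV[R]_n) : 'cV[R]_n :=
  \col_i Num.max (- gradient x i 0) 0.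

Definition projected_gradient_update (x : 'cV[R]_n) : 'cV[R]_n :=
  let z := descent x in
  if z == 0 then x else x + (l2norm z ^+ 2 / l2norm (A *m z) ^+ 2) *: z.

(* A relation rather than a function: any index maximizing z may be chosen. *)
Definition coordinate_update (x y : 'cV[R]_n) : Prop :=
  let z := descent x in
  if z == 0 then y = x else
  exists j, (forall k, z k 0 <= z j 0) /\
    y = \col_i (if i == j then z j 0 / l2norm (col j A) ^+ 2 else x i 0).

Inductive update_rule := ProjectedGradient | Coordinate.

Definition is_update (rule : update_rule) (x y : 'cV[R]_n) : Prop :=
  match rule with
  | ProjectedGradient => y = projected_gradient_update x
  | Coordinate => coordinate_update x y
  end.

Definition feasible_step (x w : 'cV[R]_n) (alpha : R) : Prop :=
  [/\ 0 <= alpha, alpha <= 1 & nonneg (x + alpha *: (w - x))].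

Definition minor_cycle (Psi : 'cV[R]_n -> 'cV[R]_n) (x y : 'cV[R]_n) : Prop :=
  exists alpha, [/\ feasible_step x (Psi x) alpha,
    (forall beta, feasible_step x (Psi x) beta -> beta <= alpha) &
    y = x + alpha *: (Psi x - x)].

(* The control state is determined by the current point x: if Psi x != x, the
   inner loop is active and a minor cycle is performed; otherwise the current
   major cycle is over and the next one begins with an update. *)
Definition next_iterate (rule : update_rule) (Psi : 'cV[R]_n -> 'cV[R]_n)
    (x y : 'cV[R]_n) : Prop :=
  if Psi x == x then is_update rule x y else minor_cycle Psi x y.

(* The sequence of all iterates. Each major cycle contains exactly one update,
   so t consecutive steps amount to t minor and major cycles. The algorithm
   returns x when x = Update(x); at a stable x this means z = 0, in which case
   the only update of x is x itself, and the sequence stays at the returned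
   point forever. *)
Definition run (rule : update_rule) (Psi : 'cV[R]_n -> 'cV[R]_n)
    (u : nat -> 'cV[R]_n) : Prop :=
  stable Psi (u 0%N) /\ forall t, next_iterate rule Psi (u t) (u t.+1).

End NNLS.

(* Main.v *)
Require Import Defs.
From mathcomp Require Import boolp classical_sets reals.
From mathcomp Require Import all_boot all_order all_algebra.
From mathcomp Require Import ring lra zify.
Import Order.TTheory GRing.Theory Num.Theory.
Local Open Scope ring_scope.

(** Let x be stable, g the gradient at x, z = descent x its negative part, and
    K = m^2 kappa^2 |A|^2.

    The heart of the proof is the error bound
      gap x <= 1/2 (m kappa |z|)^2   ([gap_le_descent]).
    It compares x with an arbitrary feasible y. The vector (y - x, A (y - x)) of
    X_A is a sum of elementary vectors conformal to it
    ([conformal_decomposition]); dropping those of the form (v, 0) moves y to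
    another feasible point with the same image under A. Each remaining elementary
    vector (v, A v) has at most m nonzero entries in v, all bounded by kappa times
    an entry of A v, so the new y satisfies |y - x| <= m kappa |A (y - x)|
    ([feasible_proximity]). As the gradient vanishes on the support of a stable
    point, - <g, y - x> <= |z| |y - x|, and the error bound follows by maximizing a
    concave quadratic in |A (y - x)|.

    Both updates are exact line searches, along z and along the coordinate of the
    largest entry of z, and decrease the objective by at least |z|^2 / (2 |A|^2)
    and |z|^2 / (2 n |A|^2) respectively ([descent_le_decrease]). Together with
    the error bound, each update contracts the gap as claimed
    ([update_contraction]).

    For the number of cycles, the size of the support of the iterate serves as a
    potential. A minor cycle never increases the objective; it either reaches a
    stable point or makes a positive coordinate vanish ([minor_cycle_progress]).
    An update adds at most n (projected gradient) or 1 (coordinate) elements to the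
    support. Hence s updates and the stabilizations around them take at most
    n + 1 + s (n + 2), respectively n + 1 + 3 s, cycles ([run_after_updates]). By
    Bernoulli's inequality O(K), respectively O(n K), updates halve the gap. Since
    kappa |A| >= 1 ([kappa_spectral_ge1]), all lower-order terms are absorbed and
    the total is at most 11 n K ([run_halving]). *)

Set Implicit Arguments.
Unset Strict Implicit.
Unset Printing Implicit Defensive.

(** * Inner products and the spectral norm *)

Section InnerProduct.
Context {R : realType}.

Definition dot k (u v : 'cV[R]_k) : R := \sum_i u i 0 * v i 0.

Lemma dotC k (u v : 'cV[R]_k) : dot u v = dot v u.
Proof. by apply: eq_bigr => i _; rewrite mulrC. Qed.

Lemma dotDl k (u v w : 'cV[R]_k) : dot (u + v) w = dot u w + dot v w.
Proof. by rewrite -big_split; apply: eq_bigr => i _; rewrite !mxE mulrDl. Qed.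

Lemma dotDr k (u v w : 'cV[R]_k) : dot u (v + w) = dot u v + dot u w.
Proof. by rewrite ![dot u _]dotC dotDl. Qed.

Lemma dotZl k a (u v : 'cV[R]_k) : dot (a *: u) v = a * dot u v.
Proof. by rewrite mulr_sumr; apply: eq_bigr => i _; rewrite !mxE mulrA. Qed.

Lemma dotZr k a (u v : 'cV[R]_k) : dot u (a *: v) = a * dot u v.
Proof. by rewrite dotC dotZl dotC. Qed.

Lemma dotr0 k (u : 'cV[R]_k) : dot u 0 = 0.
Proof. by rewrite -(scale0r 0) dotZr mul0r. Qed.

Lemma dotE k (u v : 'cV[R]_k) : dot u v = (u^T *m v) 0 0.
Proof. by rewrite mxE; apply: eq_bigr => i _; rewrite mxE. Qed.

Lemma dot_trmxl m n (A : 'M[R]_(m, n)) (u : 'cV[R]_m) (v : 'cV[R]_n) :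
  dot (A^T *m u) v = dot u (A *m v).
Proof. by rewrite !dotE trmx_mul trmxK mulmxA. Qed.

Lemma l2norm_ge0 k (v : 'cV[R]_k) : 0 <= l2norm v.
Proof. exact: sqrtr_ge0. Qed.

Lemma sqr_l2norm k (v : 'cV[R]_k) : l2norm v ^+ 2 = dot v v.
Proof.
rewrite /l2norm sqr_sqrtr; first by apply: eq_bigr => i _; rewrite expr2.
by apply: sumr_ge0 => i _; exact: sqr_ge0.
Qed.

Lemma l2norm_eq0 k (v : 'cV[R]_k) : (l2norm v == 0) = (v == 0).
Proof.
apply/idP/eqP => [|->]; last first.
  by rewrite -sqrf_eq0 sqr_l2norm dotr0.
rewrite -sqrf_eq0 sqr_l2norm psumr_eq0 => [/allP v0|i _]; last first.
  by rewrite -expr2 sqr_ge0.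
apply/matrixP=> i j; rewrite ord1 mxE; apply/eqP.
by have := v0 i (mem_index_enum _); rewrite mulf_eq0 orbb.
Qed.

Lemma l2norm0 k : l2norm (0 : 'cV[R]_k) = 0.
Proof. by apply/eqP; rewrite l2norm_eq0. Qed.

Lemma l2norm_gt0 k (v : 'cV[R]_k) : (0 < l2norm v) = (v != 0).
Proof. by rewrite lt_def l2norm_ge0 l2norm_eq0 andbT. Qed.

(** Cauchy-Schwarz: expand the squared norm of |v| u - |u| v. *)
Lemma dot_le_l2norm k (u v : 'cV[R]_k) : dot u v <= l2norm u * l2norm v.
Proof.
have [->|u0] := eqVneq u 0.
  by rewrite dotC dotr0 mulr_ge0 ?l2norm_ge0.
have [->|v0] := eqVneq v 0.
  by rewrite dotr0 mulr_ge0 ?l2norm_ge0.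
have := sqr_ge0 (l2norm (l2norm v *: u + (- l2norm u) *: v)).
rewrite sqr_l2norm !(dotDl, dotDr, dotZl, dotZr) -!sqr_l2norm [dot v u]dotC.
have : 0 < l2norm u * l2norm v by rewrite mulr_gt0 ?l2norm_gt0.
by nra.
Qed.

Lemma l2normD k (u v : 'cV[R]_k) : l2norm (u + v) <= l2norm u + l2norm v.
Proof.
rewrite -ler_sqr ?nnegrE ?addr_ge0 ?l2norm_ge0 //.
rewrite sqr_l2norm !(dotDl, dotDr) sqrrD !sqr_l2norm [dot v u]dotC.
by have := dot_le_l2norm u v; lra.
Qed.

Lemma l2norm_sum k (I : Type) (r : seq I) (P : pred I) (F : I -> 'cV[R]_k) :
  l2norm (\sum_(i <- r | P i) F i) <= \sum_(i <- r | P i) l2norm (F i).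
Proof.
elim/big_ind2: _ => [|u a v c ua vc|//]; last first.
  by apply: le_trans (l2normD _ _) _; exact: lerD.
by rewrite le_eqVlt l2norm_eq0 eqxx.
Qed.

Lemma l2normZ k a (v : 'cV[R]_k) : l2norm (a *: v) = `|a| * l2norm v.
Proof.
apply/eqP; rewrite -(@eqrXn2 _ 2) // ?mulr_ge0 ?l2norm_ge0 //.
by rewrite exprMn real_normK ?num_real // !sqr_l2norm dotZl dotZr mulrA -expr2.
Qed.

(** Cauchy-Schwarz against the all-ones vector. *)
Lemma sqr_l1norm_le k (v : 'cV[R]_k) :
  (\sum_i `|v i 0|) ^+ 2 <= k%:R * l2norm v ^+ 2.
Proof.
pose a : 'cV[R]_k := \col_i `|v i 0|; pose o : 'cV[R]_k := const_mx 1.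
have -> : \sum_i `|v i 0| = dot o a.
  by apply: eq_bigr => i _; rewrite !mxE mul1r.
have -> : l2norm v ^+ 2 = l2norm a ^+ 2.
  rewrite !sqr_l2norm; apply: eq_bigr => i _.
  by rewrite !mxE -!expr2 real_normK ?num_real.
have -> : k%:R = l2norm o ^+ 2.
  rewrite sqr_l2norm /dot (eq_bigr (fun=> 1)) => [|i _]; last by rewrite !mxE mul1r.
  by rewrite sumr_const card_ord.
rewrite -exprMn ler_sqr ?nnegrE ?dot_le_l2norm ?mulr_ge0 ?l2norm_ge0 //.
by apply: sumr_ge0 => i _; rewrite !mxE mul1r.
Qed.

Lemma le_entry_l2norm k (v : 'cV[R]_k) i : `|v i 0| <= l2norm v.
Proof.
rewrite -ler_sqr ?nnegrE ?l2norm_ge0 // sqr_l2norm real_normK ?num_real //.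
rewrite /dot (bigD1 i) //= -expr2 lerDl; apply: sumr_ge0 => j _.
by rewrite -expr2 sqr_ge0.
Qed.

(** A supremum is only meaningful for a bounded set; A v is a combination of the
    columns of A whose coefficients are at most 1 on the unit ball. *)
Lemma has_ubound_spectral m n (A : 'M[R]_(m, n)) :
  has_ubound [set l2norm (A *m v) | v in [set v : 'cV[R]_n | l2norm v <= 1]]%classic.
Proof.
exists (\sum_j l2norm (col j A)) => _ [v /= v1 <-].
have -> : A *m v = \sum_j v j 0 *: col j A.
  apply/matrixP=> i k; rewrite ord1 summxE mxE.
  by apply: eq_bigr => j _; rewrite !mxE mulrC.
apply: le_trans (l2norm_sum _ _ _) _; apply: ler_sum => j _.
rewrite l2normZ ler_piMl ?l2norm_ge0 //.
exact: le_trans (le_entry_l2norm _ _) v1.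
Qed.

Lemma l2norm_mulmx_le m n (A : 'M[R]_(m, n)) (v : 'cV[R]_n) :
  l2norm (A *m v) <= spectral_norm A * l2norm v.
Proof.
have [->|v0] := eqVneq v 0.
  by rewrite mulmx0 !l2norm0 mulr0.
rewrite -ler_pdivrMr ?l2norm_gt0 //.
apply: ub_le_sup; first exact: has_ubound_spectral.
exists ((l2norm v)^-1 *: v).
  by rewrite /= l2normZ ger0_norm ?invr_ge0 ?l2norm_ge0 // mulVf ?l2norm_eq0.
by rewrite -scalemxAr l2normZ ger0_norm ?invr_ge0 ?l2norm_ge0 // mulrC.
Qed.

Lemma l2norm_delta n (j : 'I_n) : l2norm (delta_mx j 0 : 'cV[R]_n) = 1.
Proof.
apply/eqP; rewrite -(@eqrXn2 _ 2) // ?l2norm_ge0 // sqr_l2norm /dot (bigD1 j) //=.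
rewrite big1 => [|i ij]; first by rewrite !mxE eqxx mulr1 addr0 expr1n.
by rewrite !mxE (negbTE ij) mul0r.
Qed.

Lemma l2norm_col_le m n (A : 'M[R]_(m, n)) j : l2norm (col j A) <= spectral_norm A.
Proof.
by have := l2norm_mulmx_le A (delta_mx j 0); rewrite -colE l2norm_delta mulr1.
Qed.

End InnerProduct.

(** * Elementary vectors and the circuit imbalance *)

Section Circuits.
Context {R : realType}.

Lemma supp0 k (g : 'cV[R]_k) : (supp g == set0) = (g == 0).
Proof.
apply/eqP/eqP => [g0|->]; last by apply/setP=> i; rewrite !inE mxE eqxx.
apply/matrixP=> i j; rewrite ord1 mxE; apply/eqP.
by move/setP/(_ i): g0; rewrite !inE => /negbFE.
Qed.

Lemma suppZ k a (g : 'cV[R]_k) : a != 0 -> supp (a *: g) = supp g.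
Proof. by move=> a0; apply/setP => i; rewrite !inE mxE mulf_eq0 negb_or a0. Qed.

Lemma elementaryZ k (W : {vspace 'cV[R]_k}) a g :
  a != 0 -> elementary W g -> elementary W (a *: g).
Proof.
move=> a0 [gW g0 gmin]; split; first exact: memvZ.
  by rewrite scaler_eq0 negb_or a0.
by move=> h hW h0; rewrite suppZ //; exact: gmin.
Qed.

(** Cancelling a coordinate of h by a multiple of g leaves a vector of W whose
    support is strictly smaller than that of h, so it is zero by minimality. *)
Lemma elementary_proportional k (W : {vspace 'cV[R]_k}) g h :
  elementary W g -> elementary W h -> supp g = supp h ->
  exists a, h = a *: g.
Proof.
move=> [gW g0 _] [hW _ hmin] gh.
have /set0Pn[i ig] : supp g != set0 by rewrite supp0.
exists (h i 0 / g i 0); apply/eqP; rewrite -subr_eq0; apply/contraT => d0.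
have /negP[] := hmin _ (memvB hW (memvZ (h i 0 / g i 0) gW)) d0.
apply/properP; split; last first.
  exists i; rewrite -?gh // !inE !mxE divfK ?subrr ?eqxx //.
  by move: ig; rewrite inE.
apply/subsetP => j; apply: contraLR; move=> jh.
have jg : j \notin supp g by rewrite gh.
by move: jh jg; rewrite !inE !mxE !negbK => /eqP-> /eqP->; rewrite mulr0 subrr.
Qed.

(** The ratios depend on an elementary vector only through its support, by
    proportionality, and there are finitely many supports. *)
Lemma has_ubound_circuit_ratio k (W : {vspace 'cV[R]_k}) :
  has_ubound [set r : R | exists g i j,
    [/\ elementary W g, i \in supp g, j \in supp g & r = `|g j 0 / g i 0| ]]%classic.
Proof.
have bnd (S : {set 'I_k}) : exists c : R, 0 <= c /\ forall g i j,
    elementary W g -> supp g = S -> `|g j 0 / g i 0| <= c.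
  case: (pselect (exists g, elementary W g /\ supp g = S)) => [[g [gW gS]]|no].
    exists (\sum_i \sum_j `|g j 0 / g i 0|); split.
      by apply: sumr_ge0 => i _; apply: sumr_ge0.
    move=> h i j hW hS.
    have [a h_ag] := elementary_proportional gW hW (etrans gS (esym hS)).
    have a0 : a != 0.
      by apply/eqP => a0; case: hW => _; rewrite h_ag a0 scale0r eqxx.
    rewrite h_ag !mxE -mulf_div divff // mul1r (bigD1 i) //= (bigD1 j) //=.
    rewrite -addrA lerDl addr_ge0 ?sumr_ge0 // => l _; exact: sumr_ge0.
  exists 0; split=> // g i j gW gS; case: no; by exists g.
have [c cP] := choice bnd.
exists (\sum_S c S) => _ [g [i [j [gW _ _ ->]]]].
apply: le_trans ((cP (supp g)).2 g i j gW erefl) _.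
by rewrite (bigD1 (supp g)) //= lerDl sumr_ge0 // => S _; have [] := cP S.
Qed.

(** The form in which the circuit imbalance is used. When W is the whole space,
    kappa is 1 by convention; this is consistent because the elementary vectors
    are then the multiples of the unit vectors. *)
Lemma circuit_ratio_le k (W : {vspace 'cV[R]_k}) g i j :
  elementary W g -> i \in supp g -> `|g j 0| <= kappa W * `|g i 0|.
Proof.
move=> gW ig; have gi0 : g i 0 != 0 by move: ig; rewrite inE.
suff le_k (l : 'I_k) : l \in supp g -> `|g l 0 / g i 0| <= kappa W.
  have k1 : 1 <= kappa W by have := le_k i ig; rewrite divff // normr1.
  have [jg|] := boolP (j \in supp g); last first.
    by rewrite inE negbK => /eqP->; rewrite normr0 mulr_ge0 // (le_trans ler01).
  by rewrite -ler_pdivrMr ?normr_gt0 // -normf_div le_k.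
move=> lg; rewrite /kappa; case: ifP => [/orP[]/eqP W0|_]; last first.
  by apply: ub_le_sup; [exact: has_ubound_circuit_ratio|exists g, i, l].
- have e0 : delta_mx i 0 != 0 :> 'cV[R]_k.
    by apply/eqP => /matrixP/(_ i 0)/eqP; rewrite !mxE !eqxx oner_eq0.
  case: gW => _ _ /(_ (delta_mx i 0)); rewrite W0 memvf e0 => /(_ isT isT).
  have sp : supp (delta_mx i 0 : 'cV[R]_k) = [set i]%SET.
    by apply/setP => h; rewrite !inE !mxE eqxx andbT pnatr_eq0 eqb0 negbK.
  rewrite sp properEneq sub1set ig andbT negbK => /eqP sg.
  by move: lg; rewrite -sg => /set1P->; rewrite divff // normr1.
- by case: gW; rewrite W0 memv0 => ->.
Qed.

Lemma kappa_ge0 k (W : {vspace 'cV[R]_k}) : 0 <= kappa W.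
Proof.
rewrite /kappa; case: ifP => // _.
set E := (X in sup X); have [supE|/sup_out-> //] := pselect (has_sup E).
have [r Er] := supE.1; apply: le_trans (ub_le_sup supE.2 Er).
by case: Er => g [i [j [_ _ _ ->]]].
Qed.

(** Ratio test: move from u along - h until a first coordinate of u that has the
    same sign in h vanishes. No coordinate of u changes sign on the way. *)
Lemma maximal_conformal_multiple k (u h : 'cV[R]_k) :
  (exists i, 0 < h i 0 * u i 0) ->
  exists t, [/\ 0 < t, forall i, 0 <= (u - t *: h) i 0 * u i 0 &
    exists2 i, u i 0 != 0 & (u - t *: h) i 0 = 0].
Proof.
move=> [i0 i0P].
case: (@arg_minP _ _ _ i0 (fun i => 0 < h i 0 * u i 0) (fun i => u i 0 / h i 0) i0P).
move=> i iP imin; exists (u i 0 / h i 0).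
have nz l : 0 < h l 0 * u l 0 -> h l 0 != 0 /\ u l 0 != 0.
  by move=> /lt0r_neq0; rewrite mulf_eq0 negb_or => /andP[].
have [hi0 ui0] := nz _ iP.
have t0 : 0 < u i 0 / h i 0.
  have -> : u i 0 / h i 0 = h i 0 * u i 0 / h i 0 ^+ 2 by field.
  by rewrite divr_gt0 // lt_def sqr_ge0 expf_neq0.
split=> [//|j|]; last by exists i => //; rewrite !mxE divfK ?subrr.
rewrite !mxE mulrBl -mulrA subr_ge0.
have [jP|jP] := ltP 0 (h j 0 * u j 0); last first.
  apply: (@le_trans _ _ 0); last by rewrite -expr2 sqr_ge0.
  by rewrite pmulr_rle0.
have [hj0 uj0] := nz _ jP.
have := imin j jP; rewrite -(ler_pM2r jP) => /le_trans; apply.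
by rewrite mulrA divfK.
Qed.

Lemma supp_sub_multiple k (u h : 'cV[R]_k) t i :
  supp h \subset supp u -> u i 0 != 0 -> (u - t *: h) i 0 = 0 ->
  supp (u - t *: h) \proper supp u.
Proof.
move=> /subsetP hu ui0 di0; apply/properP; split.
  apply/subsetP => j; apply: contraLR => ju.
  have jh : j \notin supp h by apply: contra ju => /hu.
  by move: ju jh; rewrite !inE !mxE !negbK => /eqP-> /eqP->; rewrite mulr0 subrr.
by exists i; rewrite inE ?ui0 // di0 eqxx.
Qed.

(** If u is not itself elementary, some h in W has strictly smaller support; up to
    sign it agrees with u somewhere, so the ratio test yields a nonzero vector
    u - t h of smaller support that is still conformal to u. *)
Lemma exists_conformal_elementary k (W : {vspace 'cV[R]_k}) u :
  u \in W -> u != 0 ->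
  exists2 g, elementary W g & forall i, g i 0 != 0 -> 0 < g i 0 * u i 0.
Proof.
have [s] := ubnP #|supp u|; elim: s u => // s IH u us uW u0.
have [uel|uel] := pselect (elementary W u).
  by exists u => // i ui0; rewrite -expr2 lt_def sqr_ge0 expf_neq0.
have [h [hW h0 hu]] : exists h, [/\ h \in W, h != 0 & supp h \proper supp u].
  apply: contrapT => no; apply: uel; split=> // h hW h0.
  by apply/negP => hu; apply: no; exists h.
(* Replacing h by - h if necessary, h and u agree in sign somewhere. *)
wlog [i hui] : h hW h0 hu / exists i, 0 < h i 0 * u i 0.
  move=> wl; have /set0Pn[i ih] : supp h != set0 by rewrite supp0.
  have iu := subsetP (proper_sub hu) _ ih.
  have : h i 0 * u i 0 != 0 by rewrite mulf_neq0 //; move: ih iu; rewrite !inE.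
  rewrite neq_lt => /orP[] lt0; last by apply: (wl h) => //; exists i.
  apply: (wl (-1 *: h)); rewrite ?memvZ ?suppZ ?scaler_eq0 ?oppr_eq0 ?oner_eq0 //.
  by exists i; rewrite mxE mulN1r mulNr oppr_gt0.
have [t [t0 conf [l ul0 dl0]]] := maximal_conformal_multiple (ex_intro _ i hui).
have dlt := supp_sub_multiple (proper_sub hu) ul0 dl0.
(* u is not a multiple of h, as its support is strictly larger. *)
have d0 : u - t *: h != 0.
  apply: contraTneq hu => /eqP; rewrite subr_eq0 => /eqP->.
  by rewrite suppZ ?gt_eqF // properxx.
have [||//|g gW gd] := IH (u - t *: h).
- by apply: leq_trans (proper_card dlt) _; rewrite -ltnS.
- by rewrite memvB ?memvZ.
exists g => // j gj0; have := gd j gj0 => gdj.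
have dj0 : (u - t *: h) j 0 != 0.
  by move/lt0r_neq0: gdj; rewrite mulf_eq0 negb_or => /andP[].
have uj0 : u j 0 != 0.
  by have := subsetP (proper_sub dlt) j; rewrite [in X in X -> _]inE dj0 inE => ->.
have : 0 < (u - t *: h) j 0 * u j 0 by rewrite lt_def conf mulf_neq0.
set d := (u - t *: h) j 0 in gdj dj0 * => duj.
have : 0 < (g j 0 * u j 0) * d ^+ 2.
  by have := mulr_gt0 gdj duj; congr (_ < _); ring.
by rewrite pmulr_lgt0 // lt_def sqr_ge0 expf_neq0.
Qed.

(** Peel off maximal multiples of conformal elementary vectors; each peeling
    shrinks the support. Conformality is recorded as additivity of absolute
    values, which is what makes l1 norms add up over the decomposition. *)
Lemma conformal_decomposition k (W : {vspace 'cV[R]_k}) u : u \in W ->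
  exists gs : seq 'cV[R]_k,
    [/\ forall g, g \in gs -> elementary W g, u = \sum_(g <- gs) g &
        forall i, \sum_(g <- gs) `|g i 0| = `|u i 0|].
Proof.
have [s] := ubnP #|supp u|; elim: s u => // s IH u us uW.
have [->|u0] := eqVneq u 0.
  by exists [::]; split=> [//||i]; rewrite big_nil // mxE normr0.
have [g gW gu] := exists_conformal_elementary uW u0.
have [_ g0 _] := gW.
have /set0Pn[i ig] : supp g != set0 by rewrite supp0.
have gi0 : g i 0 != 0 by move: ig; rewrite inE.
have [t [t0 conf [l ul0 dl0]]] :=
  maximal_conformal_multiple (ex_intro _ i (gu i gi0)).
have sub_gu : supp g \subset supp u.
  apply/subsetP => j; rewrite inE => /gu /lt0r_neq0.
  by rewrite mulf_eq0 negb_or inE => /andP[].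
have dlt := supp_sub_multiple sub_gu ul0 dl0.
have tgW : elementary W (t *: g) by apply: elementaryZ => //; rewrite gt_eqF.
have [||gs [gsW dE dA]] := IH (u - t *: g).
- by apply: leq_trans (proper_card dlt) _; rewrite -ltnS.
- by have [tgW' _ _] := tgW; rewrite memvB.
exists (t *: g :: gs); split=> [h||j]; rewrite ?inE ?big_cons.
- by case/predU1P => [->//|]; exact: gsW.
- by rewrite -dE addrC subrK.
rewrite dA; have [gj0|/gu gj0] := eqVneq (g j 0) 0.
  by rewrite !mxE gj0 mulr0 normr0 add0r subr0.
move: (conf j); rewrite !mxE => cj.
have tg : 0 < (t * g j 0) * u j 0 by rewrite -mulrA mulr_gt0.
move: cj tg; set a := t * _; set c := u j 0 => cj tg.
have c0 : c != 0 by move/lt0r_neq0: tg; rewrite mulf_eq0 negb_or => /andP[].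
move: c0; rewrite neq_lt => /orP[] c0.
  move: cj tg; rewrite nmulr_lge0 // nmulr_lgt0 // => cj tg.
  by rewrite !ler0_norm ?cj ?ltW //; ring.
move: cj tg; rewrite pmulr_lge0 // pmulr_lgt0 // => cj tg.
by rewrite !ger0_norm ?cj ?ltW //; ring.
Qed.

(** More than m columns of a matrix with m rows are linearly dependent. *)
Lemma exists_kernel_supported m n (A : 'M[R]_(m, n)) (S : {set 'I_n}) :
  (m < #|S|)%N ->
  exists v : 'cV[R]_n, [/\ v != 0, A *m v = 0 & supp v \subset S].
Proof.
move=> mS; pose f := @enum_val _ (mem S).
have /rowV0Pn[w /sub_kermxP wB w0] : kermx (rowsub f A^T) != 0.
  rewrite kermx_eq0 /row_free neq_ltn.
  by rewrite (leq_ltn_trans (rank_leq_col _)).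
exists (w *m rowsub f 1%:M)^T; split.
- apply: contraNneq w0 => v0; apply/eqP/matrixP => i j; rewrite ord1 mxE.
  move/matrixP/(_ (f j) 0): v0; rewrite !mxE (bigD1 j) //= big1 => [|l lj].
    by rewrite !mxE eqxx mulr1 addr0.
  by rewrite !mxE (inj_eq enum_val_inj) (negbTE lj) mulr0.
- by apply: trmx_inj; rewrite trmx_mul trmxK -mulmxA mul_rowsub_mx mul1mx wB trmx0.
- apply/subsetP => i; apply: contraLR => iS.
  rewrite inE negbK !mxE big1 // => l _; rewrite !mxE.
  by case: eqP => [fl|]; [move: iS; rewrite -fl enum_valP|rewrite mulr0].
Qed.

Lemma col_mx_XA m n (A : 'M[R]_(m, n)) v : col_mx v (A *m v) \in XA A.
Proof. by apply/mem_XA; exists v. Qed.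

(** Otherwise a kernel vector w supported inside v would give (w, 0) in X_A, of
    strictly smaller support because A v is nonzero. *)
Lemma card_supp_elementary_XA m n (A : 'M[R]_(m, n)) (v : 'cV[R]_n) :
  elementary (XA A) (col_mx v (A *m v)) -> A *m v != 0 -> (#|supp v| <= m)%N.
Proof.
move=> [_ _ vmin] Av0; rewrite leqNgt; apply/negP => /(exists_kernel_supported A).
move=> [w [w0 Aw0 /subsetP wv]].
have /set0Pn[i] : supp (A *m v) != set0 by rewrite supp0.
rewrite inE => iAv.
have cw0 : col_mx w (A *m w) != 0.
  by apply: contraNneq w0 => cw0; rewrite -[w](col_mxKu _ (A *m w)) cw0 linear0.
apply/negP: (vmin _ (col_mx_XA A w) cw0); rewrite negbK.
apply/properP; split; last first.
  by exists (rshift n i); rewrite inE col_mxEd // Aw0 mxE eqxx.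
apply/subsetP => j; rewrite !inE; case: (split_ordP j) => l ->.
  by rewrite !col_mxEu; have := wv l; rewrite !inE.
by rewrite !col_mxEd Aw0 mxE eqxx.
Qed.

(** All of the at most m nonzero entries of v are bounded by kappa times a single
    nonzero entry of A v. *)
Lemma l2norm_elementary_XA_le m n (A : 'M[R]_(m, n)) (v : 'cV[R]_n) :
  elementary (XA A) (col_mx v (A *m v)) -> A *m v != 0 ->
  l2norm v <= Num.sqrt m%:R * kappa (XA A) * \sum_i `|(A *m v) i 0|.
Proof.
move=> vel Av0; have vm := card_supp_elementary_XA vel Av0.
have /set0Pn[i] : supp (A *m v) != set0 by rewrite supp0.
rewrite inE => iAv; set K := kappa _.
have K0 : 0 <= K by exact: kappa_ge0.
have le_v j : `|v j 0| <= K * `|(A *m v) i 0|.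
  have := circuit_ratio_le (lshift m j) vel (i := rshift n i).
  by rewrite inE !(col_mxEd, col_mxEu) => /(_ iAv).
apply: (@le_trans _ _ (Num.sqrt m%:R * K * `|(A *m v) i 0|)); last first.
  rewrite ler_wpM2l ?mulr_ge0 ?sqrtr_ge0 // (bigD1 i) //= lerDl.
  exact: sumr_ge0.
rewrite -ler_sqr ?nnegrE ?mulr_ge0 ?sqrtr_ge0 ?l2norm_ge0 //.
rewrite sqr_l2norm -mulrA exprMn sqr_sqrtr ?ler0n //.
rewrite /dot (bigID (mem (supp v))) /= [X in _ + X]big1 => [|j]; last first.
  by rewrite inE negbK => /eqP->; rewrite mul0r.
rewrite addr0.
apply: (@le_trans _ _ (\sum_(j in supp v) (K * `|(A *m v) i 0|) ^+ 2)).
  apply: ler_sum => j _; rewrite -expr2 -(real_normK (num_real (v j 0))).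
  by rewrite ler_sqr ?nnegrE ?mulr_ge0.
by rewrite sumr_const -[_ *+ _]mulr_natl ler_wpM2r ?sqr_ge0 // ler_nat.
Qed.

(** A partial sum a of a conformal decomposition of y - x lies between 0 and y - x,
    so x + a lies between x and y. *)
Lemma conformal_part_nonneg (x y a r s t : R) :
  y - x = a + r -> `|y - x| = s + t -> `|a| <= s -> `|r| <= t ->
  0 <= x -> 0 <= y -> 0 <= x + a.
Proof.
move=> yx; rewrite !ler_norml.
by case: (ger0P (y - x)) => _ ? /andP[? ?] /andP[? ?] ? ?; lra.
Qed.

(** A Hoffman-type bound. Decompose (y - x, A (y - x)) conformally in X_A and drop
    the circuits (v, 0): the image A y is unchanged, feasibility is kept, and every
    remaining circuit is controlled by its image part. Conformality lets the l1
    norms of the image parts add up to that of A (y - x); a factor sqrt m comes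
    from the size of each circuit and another one from passing from l1 to l2. *)
Lemma feasible_proximity m n (A : 'M[R]_(m, n)) (x y : 'cV[R]_n) :
  nonneg x -> nonneg y ->
  exists y', [/\ nonneg y', A *m y' = A *m y &
    l2norm (y' - x) <= m%:R * kappa (XA A) * l2norm (A *m (y - x))].
Proof.
move=> x0 y0; set d := y - x.
have [gs [gsW dE dA]] := conformal_decomposition (col_mx_XA A d).
pose P (g : 'cV[R]_(n + m)) := dsubmx g != 0.
pose d' := \sum_(g <- gs | P g) usubmx g.
have gE g : g \in gs -> dsubmx g = A *m usubmx g.
  by move=> /gsW[/mem_XA[v ->] _ _]; rewrite col_mxKu col_mxKd.
have dsum : d = \sum_(g <- gs) usubmx g.
  by rewrite -[LHS](col_mxKu _ (A *m d)) dE linear_sum.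
have Ad' : A *m d' = A *m d.
  rewrite dsum !mulmx_sumr [RHS](bigID P) /= [X in _ = _ + X]big_seq_cond.
  rewrite [X in _ = _ + X]big1 ?addr0 // => g /andP[gg].
  by rewrite /P negbK gE // => /eqP.
exists (x + d'); split.
- move=> i; pose r := \sum_(g <- gs | ~~ P g) usubmx g.
  have dr : y i 0 - x i 0 = d' i 0 + r i 0.
    have -> : y i 0 - x i 0 = d i 0 by rewrite !mxE.
    by rewrite dsum (bigID P) /= mxE.
  have nd : `|y i 0 - x i 0| = \sum_(g <- gs | P g) `|usubmx g i 0|
                             + \sum_(g <- gs | ~~ P g) `|usubmx g i 0|.
    have -> : y i 0 - x i 0 = d i 0 by rewrite !mxE.
    rewrite -(col_mxEu d (A *m d)) -dA (bigID P) /=.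
    by congr (_ + _); apply: eq_bigr => g _; rewrite mxE.
  rewrite mxE; apply: (conformal_part_nonneg dr nd) => //.
    by rewrite summxE ler_norm_sum.
  by rewrite summxE ler_norm_sum.
- by rewrite mulmxDr Ad' -mulmxDr addrC subrK.
rewrite addrC addKr.
have le_g g : g \in gs -> P g ->
    l2norm (usubmx g) <= Num.sqrt m%:R * kappa (XA A) * \sum_i `|dsubmx g i 0|.
  move=> gg gP; rewrite gE //; apply: l2norm_elementary_XA_le; rewrite -gE //.
  by rewrite vsubmxK; exact: gsW.
apply: le_trans (l2norm_sum _ _ _) _.
apply: (@le_trans _ _ (Num.sqrt m%:R * kappa (XA A) * \sum_i `|(A *m d) i 0|)).
  have -> : \sum_i `|(A *m d) i 0| = \sum_(g <- gs) \sum_i `|dsubmx g i 0|.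
    rewrite exchange_big; apply: eq_bigr => i _.
    by rewrite -(col_mxEd d (A *m d)) -dA; apply: eq_bigr => g _; rewrite mxE.
  rewrite mulr_sumr [leRHS](bigID P) /= ler_wpDr //.
    apply: sumr_ge0 => g _; rewrite !mulr_ge0 ?sqrtr_ge0 ?kappa_ge0 //.
    exact: sumr_ge0.
  rewrite big_seq_cond [leRHS]big_seq_cond.
  by apply: ler_sum => g /andP[]; exact: le_g.
have -> : m%:R * kappa (XA A) * l2norm (A *m d) =
    Num.sqrt m%:R * kappa (XA A) * (Num.sqrt m%:R * l2norm (A *m d)).
  by rewrite -[X in X * _ * _](@sqr_sqrtr R) ?ler0n //; ring.
rewrite ler_wpM2l ?mulr_ge0 ?sqrtr_ge0 ?kappa_ge0 //.
rewrite -ler_sqr ?nnegrE ?mulr_ge0 ?sqrtr_ge0 ?l2norm_ge0 ?sumr_ge0 //.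
by rewrite exprMn sqr_sqrtr ?ler0n // sqr_l1norm_le.
Qed.

End Circuits.

Section Kappa.
Context {R : realType}.

(** For a nonzero entry a = A i j, the vector (e_j, A^j) is elementary and has the
    entries 1 and a, so kappa is at least 1/|a|, while the spectral norm is at least
    |a|. This keeps the additive and rounding terms of the cycle count below the
    main term. *)
Lemma kappa_spectral_ge1 m n (A : 'M[R]_(m, n)) :
  A != 0 -> 1 <= kappa (XA A) * spectral_norm A.
Proof.
move=> A0; have [i [j Aij]] : exists i j, A i j != 0.
  apply: contrapT => no; move/eqP: A0; apply; apply/matrixP => i j.
  by rewrite mxE; apply: contrapT => /eqP Aij; apply: no; exists i, j.
pose g := col_mx (delta_mx j 0) (A *m delta_mx j 0) : 'cV[R]_(n + m).
have gj : g (lshift m j) 0 = 1 by rewrite col_mxEu mxE !eqxx.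
have gi : g (rshift n i) 0 = A i j by rewrite col_mxEd -colE mxE.
have gel : elementary (XA A) g.
  split; first exact: col_mx_XA.
    by apply: contra_neq (oner_neq0 R) => g0; rewrite -gj g0 mxE.
  move=> _ /mem_XA[v ->] v0; apply/negP => /properP[/subsetP vg [l lg lv]].
  have vj : v = v j 0 *: delta_mx j 0.
    apply/matrixP => k c; rewrite ord1 !mxE eqxx andbT.
    have [->|kj] := eqVneq k j; first by rewrite mulr1.
    have := vg (lshift m k); rewrite !inE !col_mxEu mxE (negbTE kj) eqxx mulr0.
    by have [//|_ /(_ isT)] := eqVneq (v k 0) 0; rewrite eqxx.
  have vE : col_mx v (A *m v) = v j 0 *: g.
    by rewrite scale_col_mx scalemxAr -vj.
  have vj0 : v j 0 != 0.
    by apply: contra_neq v0 => vj0; rewrite vE vj0 scale0r.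
  by move/negP: lv; apply; rewrite vE suppZ.
have := circuit_ratio_le (lshift m j) gel (i := rshift n i).
rewrite inE gi gj normr1 => /(_ Aij)/le_trans; apply.
rewrite ler_wpM2l ?kappa_ge0 //.
apply: le_trans (l2norm_col_le A j); have := le_entry_l2norm (col j A) i.
by rewrite mxE.
Qed.

End Kappa.

(** * Progress of a single update *)

(** The factor lost when the whole gradient direction is replaced by its largest
    coordinate. *)
Definition dimension_factor {R : realType} (n : nat) (rule : update_rule) : R :=
  if rule is Coordinate then n%:R else 1.

Section LeastSquares.
Context {R : realType} {m n : nat}.
Variables (A : 'M[R]_(m, n)) (b : 'cV[R]_m).
Implicit Types x y z d : 'cV[R]_n.

Lemma objectiveD x d : objective A b (x + d) =
  objective A b x + dot (gradient A b x) d + 2^-1 * dot (A *m d) (A *m d).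
Proof.
rewrite /objective !sqr_l2norm /gradient dot_trmxl.
have -> : A *m (x + d) - b = A *m x - b + A *m d by rewrite mulmxDr addrAC.
move: (A *m x - b) => r; rewrite !(dotDl, dotDr) [dot (A *m d) r]dotC.
by field.
Qed.

Lemma objective_ge0 x : 0 <= objective A b x.
Proof. by rewrite mulr_ge0 ?invr_ge0 ?sqr_ge0. Qed.

Lemma ler_objective x y :
  (objective A b x <= objective A b y) =
  (l2norm (A *m x - b) <= l2norm (A *m y - b)).
Proof. by rewrite ler_pM2l ?invr_gt0 // ler_sqr ?nnegrE ?l2norm_ge0. Qed.

Lemma gap_ge0 x : nonneg x -> 0 <= gap A b x.
Proof.
move=> x0; rewrite subr_ge0; apply: ge_inf; last by exists x.
by exists 0 => _ [y _ <-]; exact: objective_ge0.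
Qed.

(** The optimum value is an infimum, so a bound against every feasible competitor
    is a bound on the gap. *)
Lemma gap_le x c :
  (forall y, nonneg y -> objective A b x - objective A b y <= c) ->
  gap A b x <= c.
Proof.
move=> xc; rewrite /gap lerBlDr -lerBlDl; apply: lb_le_inf.
  by exists (objective A b 0); exists 0 => // i; rewrite /= mxE.
by move=> _ [y y0 <-]; rewrite lerBlDl -lerBlDr xc.
Qed.

Lemma descentE x i : descent A b x i 0 = Num.max (- gradient A b x i 0) 0.
Proof. by rewrite [LHS]mxE. Qed.

Lemma descent_ge0 x i : 0 <= descent A b x i 0.
Proof. by rewrite descentE le_max lexx orbT. Qed.

Lemma descent_geN x i : - gradient A b x i 0 <= descent A b x i 0.
Proof. by rewrite descentE le_max lexx. Qed.

Lemma gradientE x i :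
  0 < descent A b x i 0 -> gradient A b x i 0 = - descent A b x i 0.
Proof. by rewrite descentE lt_max ltxx orbF => g0; rewrite max_l ?opprK ?ltW. Qed.

Lemma dot_gradient_descent x :
  dot (gradient A b x) (descent A b x) = - l2norm (descent A b x) ^+ 2.
Proof.
rewrite sqr_l2norm /dot -sumrN; apply: eq_bigr => i _.
have := descent_ge0 x i; rewrite le_eqVlt => /predU1P[<-|/gradientE->].
  by rewrite !mulr0 oppr0.
by rewrite mulNr.
Qed.

(** Complementary slackness, without the sign condition on the gradient that would
    make x optimal. *)
Definition complementary x := forall i, x i 0 != 0 -> gradient A b x i 0 = 0.

Lemma gradient_delta x i : dot (gradient A b x) (delta_mx i 0) = gradient A b x i 0.
Proof.
rewrite /dot (bigD1 i) //= big1 => [|j ji]; first by rewrite !mxE !eqxx mulr1 addr0.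
by rewrite [delta_mx _ _ _ _]mxE (negbTE ji) mulr0.
Qed.

(** A stable point minimizes the residual over its coordinate subspace, so the
    derivative along each e_i with x_i nonzero vanishes. *)
Lemma stable_complementary Psi x :
  centroid_mapping A b Psi -> stable Psi x -> complementary x.
Proof.
move=> [cP _] [x0 xP] i xi0; have [] := cP x x0; rewrite xP => _ xmin.
set g := gradient A b x i 0; pose c := dot (A *m delta_mx i 0) (A *m delta_mx i 0).
have c0 : 0 <= c by rewrite /c -sqr_l2norm sqr_ge0.
(* The objective along e_i is a quadratic in the step s, minimal at s = 0. *)
have key s : 0 <= s * g + 2^-1 * (s ^+ 2 * c).
  have : vanishes_on_I0 x (x + s *: delta_mx i 0).
    move=> j xj0; rewrite !mxE xj0 add0r; case: eqP => [ji|]; rewrite ?mulr0 //.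
    by move: xi0; rewrite -ji xj0 eqxx.
  move/xmin; rewrite -ler_objective objectiveD -scalemxAr !dotZl !dotZr.
  rewrite gradient_delta -/g -/c => h; rewrite expr2 -mulrA; lra.
(* 1 + c instead of the curvature c avoids a case analysis on c = 0. *)
apply/eqP; apply: contraT => g0; have := key (- g / (1 + c)).
have c1 : 1 + c != 0 by rewrite gt_eqF // ltr_wpDr.
have -> : - g / (1 + c) * g + 2^-1 * ((- g / (1 + c)) ^+ 2 * c) =
  - ((g / (1 + c)) ^+ 2 * (1 + c / 2)) by field.
rewrite oppr_ge0 pmulr_lle0; last by rewrite ltr_wpDr // divr_ge0.
rewrite le_eqVlt ltNge sqr_ge0 orbF sqrf_eq0.
by rewrite mulf_eq0 invr_eq0 (negbTE g0) (negbTE c1).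
Qed.

(** The error bound. Replace the competitor y by the nearby y' of the proximity
    bound, which has the same objective value because it has the same image under
    A. With d = y' - x and z = descent x, the objective at x exceeds that at y' by
    - <g, d> - |A d|^2 / 2. Here - <g, d> <= <z, d>: where x is positive both sides
    vanish, and elsewhere d is nonnegative. With |d| <= m kappa |A d| it remains to
    maximize a concave quadratic in |A d|. *)
Lemma gap_le_descent x : nonneg x -> complementary x ->
  gap A b x <= 2^-1 * (m%:R * kappa (XA A) * l2norm (descent A b x)) ^+ 2.
Proof.
move=> x0 xc; apply: gap_le => y /(feasible_proximity A x0)[y' [y'0 Ay' prox]].
set z := descent A b x in prox *; set K := m%:R * kappa (XA A) in prox *.
have -> : objective A b y = objective A b y' by rewrite /objective Ay'.
set d := y' - x in prox; have -> : y' = x + d by rewrite addrC subrK.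
rewrite objectiveD -sqr_l2norm.
have gz : - dot (gradient A b x) d <= dot z d.
  rewrite -sumrN; apply: ler_sum => i _; rewrite -mulNr.
  have [xi0|/xc gi] := eqVneq (x i 0) 0.
    by rewrite ler_wpM2r ?descent_geN // !mxE xi0 subr0.
  by rewrite /z descentE gi oppr0 maxxx.
have zd := dot_le_l2norm z d.
have Ad : A *m (y - x) = A *m d by rewrite !mulmxBr Ay'.
rewrite Ad in prox; have z0 := l2norm_ge0 z.
have := ler_wpM2l z0 prox; move: gz zd.
move: (l2norm z) (l2norm d) (l2norm (A *m d)) => zn dn q gz zd zdq.
have := sqr_ge0 (q - K * zn).
nra.
Qed.

(** The step length is the exact line search along z, and the decrease it achieves
    is |z|^4 / (2 |A z|^2). *)
Lemma descent_le_decrease_gradient x y : y = projected_gradient_update A b x ->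
  l2norm (descent A b x) ^+ 2 <=
  2 * spectral_norm A ^+ 2 * (objective A b x - objective A b y).
Proof.
rewrite /projected_gradient_update /=; set z := descent A b x.
have [->|z0] := eqVneq z 0; first by move=> ->; rewrite l2norm0 expr0n subrr mulr0.
have zn0 : 0 < l2norm z by rewrite l2norm_gt0.
have Az0 : A *m z != 0.
  apply/eqP => Az; have := dot_gradient_descent x; rewrite dot_trmxl Az dotr0.
  by move/eqP; rewrite eq_sym oppr_eq0 sqrf_eq0 l2norm_eq0 (negbTE z0).
have An0 : 0 < l2norm (A *m z) by rewrite l2norm_gt0.
move=> ->; rewrite objectiveD -scalemxAr dotZl !dotZr dot_gradient_descent -/z.
rewrite -sqr_l2norm; have := l2norm_mulmx_le A z.
move: (l2norm z) (l2norm (A *m z)) (spectral_norm A) zn0 An0 => u v a u0 v0 vau.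
have -> : 2 * a ^+ 2 * (objective A b x -
    (objective A b x + u ^+ 2 / v ^+ 2 * (- u ^+ 2) +
     2^-1 * (u ^+ 2 / v ^+ 2 * (u ^+ 2 / v ^+ 2 * v ^+ 2)))) =
    (a * u) ^+ 2 / v ^+ 2 * u ^+ 2.
  by field; rewrite gt_eqF.
rewrite ler_peMl ?sqr_ge0 // ler_pdivlMr ?exprn_gt0 // mul1r.
by rewrite ler_sqr ?nnegrE ?(ltW v0) ?(le_trans (ltW v0)).
Qed.

(** The chosen coordinate has a negative partial derivative, so it is zero at x by
    complementarity, and overwriting it is the same as adding a multiple of e_j. *)
Lemma coordinate_updateE x y : complementary x -> coordinate_update A b x y ->
  descent A b x != 0 ->
  exists j, [/\ forall k, descent A b x k 0 <= descent A b x j 0,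
    0 < descent A b x j 0 &
    y = x + (descent A b x j 0 / l2norm (col j A) ^+ 2) *: delta_mx j 0].
Proof.
rewrite /coordinate_update /= => xc + z0; rewrite (negbTE z0) => -[j [jmax ->]].
have zj0 : 0 < descent A b x j 0.
  have /set0Pn[i] : supp (descent A b x) != set0 by rewrite supp0.
  rewrite inE => iz; apply: lt_le_trans (jmax i).
  by rewrite lt_def iz descent_ge0.
exists j; split=> //; apply/matrixP => i c; rewrite ord1 !mxE eqxx andbT.
case: eqP => [->|_]; last by rewrite mulr0 addr0.
suff -> : x j 0 = 0 by rewrite add0r mulr1.
apply/eqP; apply: contraT => /xc; rewrite gradientE // => /eqP.
by rewrite oppr_eq0 gt_eqF.
Qed.

(** The new coordinate is the exact line search along e_j; the decrease is
    z_j^2 / (2 |A^j|^2), where z_j^2 is at least the average of the z_k^2. *)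
Lemma descent_le_decrease_coordinate x y :
  complementary x -> coordinate_update A b x y ->
  l2norm (descent A b x) ^+ 2 <=
  2 * n%:R * spectral_norm A ^+ 2 * (objective A b x - objective A b y).
Proof.
move=> xc xy; have [z0|z0] := eqVneq (descent A b x) 0.
  move: xy; rewrite /coordinate_update /= z0 eqxx => ->.
  by rewrite l2norm0 expr0n subrr mulr0.
have [j [jmax zj0 ->]] := coordinate_updateE xc xy z0.
have gj := gradient_delta x j; rewrite gradientE // in gj.
have Aj0 : col j A != 0.
  apply/eqP => Aj; move: gj; rewrite dot_trmxl -colE Aj dotr0.
  by move/eqP; rewrite eq_sym oppr_eq0 gt_eqF.
rewrite objectiveD -scalemxAr dotZl !dotZr gj -colE -sqr_l2norm.
apply: (@le_trans _ _ (n%:R * descent A b x j 0 ^+ 2)).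
  rewrite sqr_l2norm -[n in n%:R]card_ord -sum1_card natr_sum mulr_suml.
  apply: ler_sum => i _; rewrite mul1r -expr2 ler_sqr ?nnegrE ?descent_ge0 //.
have := l2norm_col_le A j; have : 0 < l2norm (col j A) by rewrite l2norm_gt0.
move: (l2norm _) (spectral_norm A) (descent A b x j 0) zj0 => v a z z0' v0 va.
have -> : 2 * n%:R * a ^+ 2 * (objective A b x -
   (objective A b x + z / v ^+ 2 * (- z) +
    2^-1 * (z / v ^+ 2 * (z / v ^+ 2 * v ^+ 2)))) =
   n%:R * z ^+ 2 * (a ^+ 2 / v ^+ 2) by field; rewrite gt_eqF.
rewrite ler_peMr ?(mulr_ge0 _ (sqr_ge0 z)) // ler_pdivlMr ?exprn_gt0 // mul1r.
by rewrite ler_sqr ?nnegrE ?(ltW v0) ?(le_trans (ltW v0)).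
Qed.

Definition contraction_constant (rule : update_rule) : R :=
  2 * dimension_factor n rule * m%:R ^+ 2 * kappa (XA A) ^+ 2 * spectral_norm A ^+ 2.

Lemma descent_le_decrease rule x y : complementary x -> is_update A b rule x y ->
  l2norm (descent A b x) ^+ 2 <=
  2 * dimension_factor n rule * spectral_norm A ^+ 2 *
    (objective A b x - objective A b y).
Proof.
case: rule => xc xy; last exact: descent_le_decrease_coordinate.
by rewrite mulr1; exact: descent_le_decrease_gradient.
Qed.

Lemma update_nonneg rule x y : nonneg x -> complementary x ->
  is_update A b rule x y -> nonneg y.
Proof.
move=> x0 xc xy i; have [z0|z0] := eqVneq (descent A b x) 0.
  move: xy; rewrite /is_update /coordinate_update /projected_gradient_update /=.
  by rewrite z0 eqxx; case: rule => ->.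
case: rule xy => [->|xy] /=.
  rewrite /projected_gradient_update /= (negbTE z0) !mxE addr_ge0 //.
  by rewrite mulr_ge0 ?divr_ge0 ?sqr_ge0 // le_max lexx orbT.
have [j [_ zj0 ->]] := coordinate_updateE xc xy z0.
rewrite [X in _ <= X]mxE addr_ge0 // !mxE mulr_ge0 //.
by rewrite mulr_ge0 ?invr_ge0 ?sqr_ge0 // le_max lexx orbT.
Qed.

Lemma contraction_constant_ge2 rule : (0 < m)%N -> (0 < n)%N -> A != 0 ->
  2 <= contraction_constant rule.
Proof.
move=> m0 n0 A0; have k1 := kappa_spectral_ge1 A0.
have -> : contraction_constant rule = 2 * (dimension_factor n rule *
    (m%:R ^+ 2 * (kappa (XA A) * spectral_norm A) ^+ 2)).
  by rewrite /contraction_constant; ring.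
rewrite ler_peMr //.
apply: mulr_ege1; first by case: rule; rewrite //= ler1n.
by apply: mulr_ege1; rewrite exprn_ege1 // ler1n.
Qed.

(** The error bound turns the decrease, which is proportional to |z|^2, into a
    fraction of the gap. *)
Lemma update_contraction rule x y :
  (0 < m)%N -> (0 < n)%N -> A != 0 -> nonneg x -> complementary x ->
  is_update A b rule x y ->
  gap A b y <= (1 - 1 / contraction_constant rule) * gap A b x.
Proof.
move=> m0 n0 A0 x0 xc xy.
have c2 := contraction_constant_ge2 rule m0 n0 A0.
have gx0 := gap_ge0 x0.
have gx := gap_le_descent x0 xc.
have dec := descent_le_decrease xc xy.
have -> : gap A b y = gap A b x - (objective A b x - objective A b y).
  by rewrite /gap; ring.
set delta := _ - objective A b y in dec *.
have gle : gap A b x <= contraction_constant rule * delta.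
  have d0 : 0 <= (m%:R * kappa (XA A)) ^+ 2 := sqr_ge0 _.
  have := ler_wpM2l d0 dec; move: gx.
  rewrite exprMn /contraction_constant.
  by move: (l2norm _ ^+ 2) => z2; rewrite [in X in X -> _]exprMn; lra.
have : gap A b x / contraction_constant rule <= delta.
  by rewrite ler_pdivrMr ?(lt_le_trans _ c2) // mulrC.
by move=> ?; rewrite div1r mulrBl mul1r [_^-1 * _]mulrC lerD2l lerN2.
Qed.

End LeastSquares.

(** * Counting the cycles of a run *)

(** How many zero coordinates a single update can make positive. *)
Definition support_growth (n : nat) (rule : update_rule) : nat :=
  if rule is Coordinate then 1 else n.

(** The arithmetic behind the constant 11: s is the number of updates, g the
    amortized number of cycles per update, and N + 1 <= 2 N K covers the potential
    at the start, leaving 9 N K for s g. *)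
Lemma cycle_count_le {R : realType} (N K d g s : R) :
  1 <= N -> 1 <= K -> 0 <= g -> d * g <= 3 * N ->
  2 <= 2 * d * K -> s <= 2 * d * K + 1 ->
  N + 1 + s * g <= 11 * (N * K).
Proof.
move=> N1 K1 g0 dg c2 sc.
have NK : N <= N * K by rewrite ler_peMr // (le_trans ler01).
have := ler_wpM2r (le_trans ler01 K1) dg.
have : s * g <= 3 * d * K * g by rewrite ler_wpM2r //; lra.
lra.
Qed.

(** The two rules balance: a projected gradient update has n times the guaranteed
    progress, but up to about n minor cycles may follow it, whereas a coordinate
    update creates a single new positive coordinate. *)
Lemma dimension_factor_growth_le {R : realType} n rule : (0 < n)%N ->
  dimension_factor n rule * (support_growth n rule + 2)%:R <= 3 * n%:R :> R.
Proof.
rewrite -(ler1n R) natrD => n1; case: rule => /=; lra.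
Qed.

Lemma card_supp_le {R : realType} n (x : 'cV[R]_n) : (#|supp x| <= n)%N.
Proof. by rewrite -[leqRHS]card_ord max_card. Qed.

(** Bernoulli in the form (1 - q)^k (1 + k q) <= 1, taken at k q >= 1. *)
Lemma expr_onem_le_half {R : realType} (c : R) s : 1 <= c -> c <= s%:R ->
  (1 - 1 / c) ^+ s <= 2^-1.
Proof.
move=> c1 cs; set q := 1 / c.
have c0 : 0 < c by rewrite (lt_le_trans _ c1).
have q0 : 0 <= q by rewrite divr_ge0 // ltW.
have q1 : q <= 1 by rewrite ler_pdivrMr // mul1r.
have bernoulli k : (1 - q) ^+ k * (1 + k%:R * q) <= 1.
  elim: k => [|k IH]; first by rewrite expr0 mul0r addr0 mulr1.
  apply: le_trans IH; rewrite exprSr -mulrA ler_wpM2l ?exprn_ge0 ?subr_ge0 //.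
  have : 0 <= (k%:R + 1) * (q * q).
    by rewrite natr1; exact: mulr_ge0 (ler0n _ _) (mulr_ge0 q0 q0).
  by rewrite -natr1; lra.
have sq : 2 <= 1 + s%:R * q.
  suff : 1 <= s%:R * q by lra.
  by rewrite mulrA mulr1 ler_pdivlMr // mul1r.
have e0 : 0 <= (1 - q) ^+ s by rewrite exprn_ge0 ?subr_ge0.
have := ler_wpM2l e0 sq; have := bernoulli s; lra.
Qed.

Section Run.
Context {R : realType} {m n : nat}.
Variables (A : 'M[R]_(m, n)) (b : 'cV[R]_m) (Psi : 'cV[R]_n -> 'cV[R]_n).
Hypothesis PsiP : centroid_mapping A b Psi.
Implicit Types x y : 'cV[R]_n.

Lemma minor_cycle_nonneg x y : minor_cycle Psi x y -> nonneg y.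
Proof. by move=> [a [[_ _ y0] _ ->]]. Qed.

(** The centroid is at least as good as x, and the objective is convex on the
    segment from x to the centroid. *)
Lemma minor_cycle_objective x y : nonneg x -> minor_cycle Psi x y ->
  objective A b y <= objective A b x.
Proof.
move=> x0 [a [[a0 a1 _] _ ->]].
have : objective A b (x + (Psi x - x)) <= objective A b x.
  by rewrite addrC subrK ler_objective; apply: (PsiP.1 x x0).2.
rewrite !objectiveD -scalemxAr !dotZr dotZl -!sqr_l2norm.
have := sqr_ge0 (l2norm (A *m (Psi x - x))).
move: (_ ^+ 2) (dot _ _) => q g q0 gq.
have aq : 0 <= a * (1 - a) * q by rewrite !mulr_ge0 // subr_ge0.
have : 0 <= a * - (g + 2^-1 * q) by apply: mulr_ge0; lra.
lra.
Qed.

Lemma supp_minor_cycle_sub x y : nonneg x -> minor_cycle Psi x y ->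
  supp y \subset supp x.
Proof.
move=> x0 [a [_ _ ->]]; apply/subsetP => i; apply: contraLR.
rewrite !inE !negbK => /eqP xi0; have [w0 _] := PsiP.1 x x0.
by rewrite !mxE w0 // xi0 subr0 mulr0 addr0.
Qed.

(** A maximal step shorter than 1 is blocked by a coordinate that reaches zero:
    otherwise all coordinates of supp x stay positive at y and a slightly longer
    step is feasible. *)
Lemma blocked_step_proper x y a : nonneg x ->
  feasible_step x (Psi x) a ->
  (forall c, feasible_step x (Psi x) c -> c <= a) ->
  y = x + a *: (Psi x - x) -> a < 1 -> supp y \proper supp x.
Proof.
move=> x0 ast amax yE a1.
have ysub : supp y \subset supp x by apply: supp_minor_cycle_sub => //; exists a.
rewrite properE ysub; apply/negP => /subsetP xy.
have [a0 _ y0] := ast; rewrite -yE in y0.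
pose d i : R := (Psi x - x) i 0.
have d0 i : y i 0 = 0 -> d i = 0.
  move=> yi0; have /eqP xi0 : x i 0 == 0.
    by apply: contraT => xi; have := xy i; rewrite !inE yi0 eqxx xi => /(_ isT).
  by have [w0 _] := PsiP.1 x x0; rewrite /d !mxE w0 // xi0 subr0.
(* Each positive coordinate of y tolerates an extra step of length e i. *)
pose e i := y i 0 / (1 + `|d i|).
pose eps := \big[Num.min/(1 - a)]_(i | y i 0 != 0) e i.
have den i : 0 < 1 + `|d i| by rewrite ltr_pwDl.
have eps0 : 0 < eps.
  apply/bigmin_gtP; split=> [|i yi0]; first by rewrite subr_gt0.
  by rewrite divr_gt0 // lt_def yi0 y0.
have epsa : eps <= 1 - a by rewrite bigmin_le_id.
have : a + eps <= a; last by rewrite gerDl leNgt eps0.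
apply: amax; split; [by rewrite addr_ge0 // ltW|by lra|] => i.
have -> : (x + (a + eps) *: (Psi x - x)) i 0 = y i 0 + eps * d i.
  by rewrite yE /d !mxE; ring.
have [yi0|yi0] := eqVneq (y i 0) 0; first by rewrite yi0 d0 // mulr0 addr0.
have : eps <= e i by rewrite bigmin_le_cond.
rewrite ler_pdivlMr // mulrDr mulr1 => h.
have : - (eps * d i) <= eps * `|d i|.
  by rewrite -mulrN ler_wpM2l ?(ltW eps0) // -normrN ler_norm.
lra.
Qed.

(** A full step lands on the centroid, which is stable because Psi fixes its
    nonnegative values. *)
Lemma minor_cycle_progress x y : nonneg x -> minor_cycle Psi x y ->
  Psi y = y \/ supp y \proper supp x.
Proof.
move=> x0 [a [ast amax yE]]; have [_ a1 y0] := ast; move: a1; rewrite le_eqVlt.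
case/predU1P => [a1|a1]; last by right; exact: blocked_step_proper ast amax yE a1.
left; move: y0; rewrite yE a1 scale1r addrC subrK; exact: PsiP.2.
Qed.

Lemma card_supp_update rule x y : complementary A b x -> is_update A b rule x y ->
  (#|supp y| <= #|supp x| + support_growth n rule)%N.
Proof.
move=> xc; case: rule => /=; first by rewrite (leq_trans (card_supp_le y)) ?leq_addl.
move=> xy; have [z0|z0] := eqVneq (descent A b x) 0.
  by move: xy; rewrite /coordinate_update /= z0 eqxx => ->; rewrite leq_addr.
have [j [_ _ ->]] := coordinate_updateE xc xy z0.
rewrite addn1; apply: leq_trans (_ : #|j |: supp x| <= _)%N; last first.
  by rewrite cardsU1 -addn1 addnC leq_add2l; case: (_ \notin _).
apply: subset_leq_card; apply/subsetP => i; rewrite !inE.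
by have [//|ij] := eqVneq i j; rewrite !mxE (negbTE ij) mulr0 addr0.
Qed.

Variables (rule : update_rule) (u : nat -> 'cV[R]_n).
Hypotheses (m_gt0 : (0 < m)%N) (n_gt0 : (0 < n)%N) (A_neq0 : A != 0).
Hypothesis uP : run A b rule Psi u.

Lemma run_nonneg t : nonneg (u t).
Proof.
elim: t => [|t IH]; first exact: uP.1.1.
have := uP.2 t; rewrite /next_iterate; case: eqP => [st|_];
  last exact: minor_cycle_nonneg.
move=> upd; apply: (update_nonneg IH _ upd).
exact: stable_complementary PsiP (conj IH st).
Qed.

(** Every minor cycle shrinks the support, except for the last one before
    stability; the term + 1 pays for that one. The support size is kept as a
    potential, to be amortized over the major cycles. *)
Lemma run_reaches_stable t : exists k,
  [/\ Psi (u (t + k)%N) = u (t + k)%N, gap A b (u (t + k)%N) <= gap A b (u t) &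
      (k + #|supp (u (t + k)%N)| <= #|supp (u t)| + 1)%N].
Proof.
have [s] := ubnP #|supp (u t)|; elim: s t => // s IH t us.
have [st|nst] := eqVneq (Psi (u t)) (u t).
  by exists 0%N; rewrite addn0 add0n leq_addr.
have := uP.2 t; rewrite /next_iterate (negbTE nst) => mc.
have gle : gap A b (u t.+1) <= gap A b (u t).
  by rewrite lerD2r; exact: minor_cycle_objective (run_nonneg t) mc.
have sub := subset_leq_card (supp_minor_cycle_sub (run_nonneg t) mc).
have [st|/proper_card lt] := minor_cycle_progress (run_nonneg t) mc.
  by exists 1%N; rewrite addn1 addnC; split=> //; rewrite leq_add2r.
have [|k [kst kg ks]] := IH t.+1; first by apply: leq_trans lt _; rewrite -ltnS.
exists k.+1; have -> : (t + k.+1 = t.+1 + k)%N by lia.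
by split=> //; [exact: le_trans kg gle|lia].
Qed.

(** Amortized count: an update costs one cycle, raises the potential by at most
    support_growth, and the stabilization that follows costs the potential drop
    plus one. *)
Lemma run_after_updates t s : exists k,
  [/\ Psi (u (t + k)%N) = u (t + k)%N,
      gap A b (u (t + k)%N) <=
        (1 - 1 / contraction_constant A rule) ^+ s * gap A b (u t) &
      (k + #|supp (u (t + k)%N)| <=
        #|supp (u t)| + 1 + s * (support_growth n rule + 2))%N].
Proof.
elim: s => [|s [k [kst kg ks]]].
  have [k [? ? ?]] := run_reaches_stable t; exists k.
  by rewrite expr0 mul1r mul0n addn0.
have x0 := run_nonneg (t + k).
have xc : complementary A b (u (t + k)%N).
  exact: stable_complementary PsiP (conj x0 kst).
have upd : is_update A b rule (u (t + k)%N) (u (t + k).+1).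
  by have := uP.2 (t + k)%N; rewrite /next_iterate kst eqxx.
have [l [lst lg ls]] := run_reaches_stable (t + k).+1.
exists (k + l.+1)%N; have -> : (t + (k + l.+1) = (t + k).+1 + l)%N by lia.
split=> //.
  apply: le_trans lg _; apply: le_trans (update_contraction _ _ _ _ _ upd) _ => //.
  rewrite exprS -mulrA ler_wpM2l // subr_ge0 ler_pdivrMr ?mul1r.
    exact: le_trans (ler1n _ 2) (contraction_constant_ge2 _ _ _ _).
  exact: lt_le_trans (ltr0n _ 2) (contraction_constant_ge2 _ _ _ _).
by have := card_supp_update xc upd; lia.
Qed.

Lemma run_halving t : exists k : nat,
  k%:R <= 11 * n%:R * m%:R ^+ 2 * kappa (XA A) ^+ 2 * spectral_norm A ^+ 2 /\
  gap A b (u (t + k)%N) <= gap A b (u t) / 2.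
Proof.
set c := contraction_constant A rule.
have c2 : 2 <= c by exact: contraction_constant_ge2.
(* Enough updates to halve the gap: the least integer exceeding c. *)
pose s := (Num.truncn c).+1.
have [sc cs] : s%:R <= c + 1 /\ c <= s%:R.
  rewrite /s -natr1 lerD2r truncn_le ?(le_trans _ c2) //.
  by rewrite natr1 ltW // truncnS_gt.
have [k [_ kg ks]] := run_after_updates t s; exists k; split; last first.
  apply: le_trans kg _.
  rewrite [leRHS]mulrC ler_wpM2r ?(gap_ge0 _ _ (run_nonneg t)) //.
  by apply: expr_onem_le_half; rewrite // (le_trans _ c2) // ler1n.
set K : R := m%:R ^+ 2 * kappa (XA A) ^+ 2 * spectral_norm A ^+ 2.
have cE : c = 2 * dimension_factor n rule * K.
  by rewrite /c /contraction_constant /K; ring.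
have K1 : 1 <= K.
  have : 2 <= 2 * K.
    have := contraction_constant_ge2 ProjectedGradient m_gt0 n_gt0 A_neq0.
    by rewrite /contraction_constant /= /K; congr (_ <= _); ring.
  by rewrite ler_pMr.
have -> : 11 * n%:R * m%:R ^+ 2 * kappa (XA A) ^+ 2 * spectral_norm A ^+ 2 =
          11 * (n%:R * K) by rewrite /K; ring.
have kn : k%:R <= n%:R + 1 + s%:R * (support_growth n rule + 2)%:R :> R.
  rewrite -natrM natr1 -natrD ler_nat.
  by have := card_supp_le (u t); clear -ks; lia.
apply: le_trans kn _; apply: (cycle_count_le (d := dimension_factor n rule)) => //.
- by rewrite ler1n.
- exact: dimension_factor_growth_le.
- by rewrite -cE.
- by rewrite -cE.
Qed.

End Run.

Theorem theorem4p5 (R : realType) :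
  (forall (m n : nat) (A : 'M[R]_(m, n)) (b : 'cV[R]_m)
      (Psi : 'cV[R]_n -> 'cV[R]_n) (x y : 'cV[R]_n),
    (0 < m)%N -> (0 < n)%N -> \rank A = m ->
    centroid_mapping A b Psi -> stable Psi x ->
    (is_update A b ProjectedGradient x y ->
      gap A b y <=
        (1 - 1 / (2 * m%:R ^+ 2 * kappa (XA A) ^+ 2 * spectral_norm A ^+ 2))
        * gap A b x) /\
    (is_update A b Coordinate x y ->
      gap A b y <=
        (1 - 1 / (2 * n%:R * m%:R ^+ 2 * kappa (XA A) ^+ 2
                  * spectral_norm A ^+ 2))
        * gap A b x)) /\
  (exists C : R, 0 < C /\
    forall (m n : nat) (A : 'M[R]_(m, n)) (b : 'cV[R]_m)
      (Psi : 'cV[R]_n -> 'cV[R]_n) (rule : update_rule)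
      (u : nat -> 'cV[R]_n),
    (0 < m)%N -> (0 < n)%N -> \rank A = m ->
    centroid_mapping A b Psi -> run A b rule Psi u ->
    forall t : nat, exists k : nat,
      k%:R <= C * n%:R * m%:R ^+ 2 * kappa (XA A) ^+ 2 * spectral_norm A ^+ 2 /\
      gap A b (u (t + k)%N) <= gap A b (u t) / 2).
Proof.
have rank_neq0 m n (A : 'M[R]_(m, n)) : (0 < m)%N -> \rank A = m -> A != 0.
  by move=> m0 rkA; rewrite -mxrank_eq0 rkA -lt0n.
split=> [m n A b Psi x y m0 n0 /(rank_neq0 _ _ _ m0) A0 PsiP xst|].
  have xc := stable_complementary PsiP xst; have [x0 _] := xst.
  split=> /(update_contraction m0 n0 A0 x0 xc); rewrite /contraction_constant //=.
  by rewrite mulr1.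
exists 11; split=> // m n A b Psi rule u m0 n0 /(rank_neq0 _ _ _ m0) A0 PsiP uP t.
exact: (run_halving PsiP m0 n0 A0 uP).
Qed.
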